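(* Let $m\geq 1$ and $n\geq 2$ be integers and let $G=E_n+K_m$. Then $$\alpha(F_2(G))=\begin{cases}\left\lceil\frac{m+2}{2}\right\rceil & \text{if } n=2,\\[2pt] \left\lfloor\frac{m}{2}\right\rfloor+\binom{n}{2} & \text{if } n\geq 3.\end{cases}$$
   Context: $E_n$ is the edgeless graph on $n$ vertices and $K_m$ the complete graph on $m$ vertices. The join $G_1+G_2$ of disjoint graphs has vertex set $V(G_1)\cup V(G_2)$ and edge set $E(G_1)\cup E(G_2)\cup\{uv: u\in V(G_1), v\in V(G_2)\}$. For a finite simple graph $G$, the $2$-token graph $F_2(G)$ has as vertices the $2$-element subsets of $V(G)$, two adjacent iff their symmetric difference is an edge of $G$. $\alpha$ is the independence number. *)

(* Defs.v *)
From mathcomp Require Import all_boot.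

Set Implicit Arguments.
Unset Strict Implicit.
Unset Printing Implicit Defensive.

Record sgraph := SGraph {
  vertex :> finType;
  adj : rel vertex;
  adj_sym : symmetric adj;
  adj_irr : irreflexive adj
}.

Definition edges (G : sgraph) : {set {set G}} :=
  [set [set p.1; p.2] | p : G * G & adj p.1 p.2].

Lemma edgeless_sym n : symmetric (fun _ _ : 'I_n => false).
Proof. by []. Qed.

Lemma edgeless_irr n : irreflexive (fun _ : 'I_n => fun _ : 'I_n => false).
Proof. by []. Qed.

Definition edgeless (n : nat) : sgraph :=
  SGraph (@edgeless_sym n) (@edgeless_irr n).

Lemma complete_sym m : symmetric (fun x y : 'I_m => x != y).
Proof. by move=> x y; rewrite eq_sym. Qed.

Lemma complete_irr m : irreflexive (fun x y : 'I_m => x != y).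
Proof. by move=> x; rewrite eqxx. Qed.

Definition complete (m : nat) : sgraph :=
  SGraph (@complete_sym m) (@complete_irr m).

Section Join.
Variables G1 G2 : sgraph.

(* Disjointness of the two vertex sets is ensured by the sum type. *)
Definition join_adj (x y : G1 + G2) : bool :=
  match x, y with
  | inl u, inl v => adj u v
  | inr u, inr v => adj u v
  | _, _ => true
  end.

Lemma join_sym : symmetric join_adj.
Proof. by move=> [u|u] [v|v] //=; apply: adj_sym. Qed.

Lemma join_irr : irreflexive join_adj.
Proof. by move=> [u|u] /=; apply: adj_irr. Qed.

Definition join : sgraph := SGraph join_sym join_irr.

End Join.

Definition symdiff (T : finType) (A B : {set T}) : {set T} :=
  (A :\: B) :|: (B :\: A).

Section Token2.
Variable G : sgraph.

Definition token2_vertex := {A : {set G} | #|A| == 2}.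

Definition token2_adj (A B : token2_vertex) : bool :=
  symdiff (val A) (val B) \in edges G.

Lemma token2_sym : symmetric token2_adj.
Proof. by move=> A B; rewrite /token2_adj /symdiff setUC. Qed.

Lemma token2_irr : irreflexive token2_adj.
Proof.
move=> A; rewrite /token2_adj /symdiff setDv setU0.
apply/negbTE/negP=> /imsetP[[u v] _ /= /setP/(_ u)].
by rewrite !inE eqxx.
Qed.

Definition token2 : sgraph := SGraph token2_sym token2_irr.

End Token2.

Definition independent (G : sgraph) (S : {set G}) : bool :=
  [forall x in S, forall y in S, ~~ adj x y].

Definition alpha (G : sgraph) : nat :=
  \max_(S : {set G} | independent S) #|S|.

(* Main.v *)
(** Two 2-subsets are adjacent in the token graph iff they are of the form
    [{x, u}], [{x, v}] with [uv] an edge.  Let [T] be independent in the token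
    graph of [E_n + K_m], and let [a] be the number of vertices of [E_n] lying in
    some mixed member of [T].  Each of them lies in exactly one mixed member and
    in no other member, a vertex of [K_m] in a mixed member lies in no member
    inside [K_m], and the members inside [K_m] are pairwise disjoint.  Hence
    [|T| <= a + C(n - a, 2) + floor ((m - [a > 0]) / 2)], which is maximal at
    [a = 0], except that [a = 2] is better when [n = 2] and [m] is odd. *)

Require Import Defs.
From mathcomp Require Import all_boot.
From mathcomp Require Import zify.

Set Implicit Arguments.
Unset Strict Implicit.
Unset Printing Implicit Defensive.

(** * Independent sets of a token graph as families of pairs *)

Section TokenFamilies.
Variable G : sgraph.
Implicit Types T : {set {set G}}.

Definition pair_family T := forall A, A \in T -> #|A| = 2.

(** Adjacent tokens share a vertex [x], so independence can be stated without symmetric differences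
    or the subtype of 2-subsets. The case [u = v] is harmless since [adj] is irreflexive. *)
Definition token_independent T :=
  forall x u v, [set x; u] \in T -> [set x; v] \in T -> ~~ adj u v.

Lemma symdiff_pairs (x u v : G) : x != u -> x != v -> u != v ->
  symdiff [set x; u] [set x; v] = [set u; v].
Proof.
move=> xu xv uv; apply/setP=> y; rewrite !inE.
have [->|_] := eqVneq y x; first by rewrite (negPf xu) (negPf xv).
have [->|_] := eqVneq y u; first by rewrite (negPf uv).
by case: (y == v).
Qed.

Lemma cards2_neq (x u : G) : #|[set x; u]| = 2 -> x != u.
Proof. by rewrite cards2; case: (x != u). Qed.

(** The two differences are disjoint and equal in size, hence singletons, and so is [A :&: B]. *)
Lemma symdiff_cards2 (A B : {set G}) : #|A| = 2 -> #|B| = 2 ->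
  #|symdiff A B| = 2 ->
  exists x u v, [/\ A = [set x; u], B = [set x; v] & symdiff A B = [set u; v]].
Proof.
move=> cA cB; rewrite /symdiff cardsU.
have -> : (A :\: B) :&: (B :\: A) = set0.
  by apply/setP=> y; rewrite !inE; case: (y \in A); case: (y \in B).
rewrite cards0 subn0 => cAB.
have := cardsID B A; have := cardsID A B.
rewrite (setIC B A) cA cB => eB eA.
have /eqP/cards1P[x Ix] : #|A :&: B| = 1 by lia.
have /eqP/cards1P[u Du] : #|A :\: B| = 1 by lia.
have /eqP/cards1P[v Dv] : #|B :\: A| = 1 by lia.
exists x, u, v; split; last by rewrite Du Dv.
  by rewrite -(setID A B) Ix Du.
by rewrite -(setID B A) setIC Ix Dv.
Qed.

Lemma edges2 (u v : G) : u != v -> ([set u; v] \in edges G) = adj u v.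
Proof.
move=> uv; apply/imsetP/idP=> [[[p q] /= pq /setP e]|auv]; last first.
  by exists (u, v); rewrite ?inE.
rewrite inE /= in pq; have := e u; have := e v; rewrite !inE !eqxx orbT /= eq_sym.
(* An unordered pair may come from either orientation of the edge; the two mixed-up cases would
   force [u = v]. *)
move=> /esym/orP[]/eqP ev /esym/orP[]/eqP eu; subst.
- by rewrite eqxx in uv.
- by rewrite adj_sym.
- by [].
- by rewrite eqxx in uv.
Qed.

Lemma token2_independentP (S : {set token2 G}) :
  independent S <-> token_independent (val @: S).
Proof.
split=> [/forall_inP indS x u v /imsetP[A AS eA] /imsetP[B BS eB]|indS].
  have xu : x != u by apply: cards2_neq; rewrite eA; apply/eqP/(valP A).
  have xv : x != v by apply: cards2_neq; rewrite eB; apply/eqP/(valP B).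
  have [<-|uv] := eqVneq u v; first by rewrite adj_irr.
  move/forall_inP: (indS A AS) => /(_ B BS) /=.
  by rewrite /token2_adj -eA -eB symdiff_pairs // edges2.
apply/forall_inP=> A AS; apply/forall_inP=> B BS; apply/negP=> /= AB.
have [[p q] /= pq eAB] := imsetP AB; rewrite inE /= in pq.
have npq : p != q by apply: contraTneq pq => ->; rewrite adj_irr.
have [||| x [u [v [eA eB eD]]]] := @symdiff_cards2 (val A) (val B).
- exact/eqP/(valP A).
- exact/eqP/(valP B).
- by rewrite eAB cards2 npq.
have uv : u != v by apply: cards2_neq; rewrite -eD eAB cards2 npq.
have := indS x u v; rewrite -eA -eB !imset_f // => /(_ isT isT) /negP; apply.
by rewrite -edges2 // -eD.
Qed.

Lemma alpha_token2_le k :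
    (forall T, pair_family T -> token_independent T -> #|T| <= k) ->
  alpha (token2 G) <= k.
Proof.
move=> le_k; apply/bigmax_leqP=> S /token2_independentP indS.
rewrite -(card_imset _ val_inj); apply: le_k => // _ /imsetP[A _ ->].
exact/eqP/(valP A).
Qed.

Lemma le_alpha_token2 T :
  pair_family T -> token_independent T -> #|T| <= alpha (token2 G).
Proof.
move=> T2 indT; pose S : {set token2 G} := [set A | val A \in T].
have eT : val @: S = T.
  apply/setP=> A; apply/imsetP/idP=> [[B BS ->]|AT]; first by rewrite inE in BS.
  have A2 : #|A| == 2 by apply/eqP/T2.
  by exists (Sub A A2); rewrite ?inE SubK.
rewrite -eT (card_imset _ val_inj).
apply: (@leq_bigmax_cond _ _ (fun S : {set token2 G} => #|S|)).
by apply/token2_independentP; rewrite eT.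
Qed.

End TokenFamilies.

(** * Tokens on the join of [E_n] and [K_m] *)

Section JoinTokens.
Variables m n : nat.
Let G := join (edgeless n) (complete m).
Let L : {set G} := inl @: [set: 'I_n].

Lemma card_inl (B : {set 'I_n}) : #|(inl @: B : {set G})| = #|B|.
Proof. by apply: card_imset => ? ? []. Qed.

Lemma card_inr (B : {set 'I_m}) : #|(inr @: B : {set G})| = #|B|.
Proof. by apply: card_imset => ? ? []. Qed.

Lemma in_inl (B : {set 'I_n}) e : ((inl e : G) \in inl @: B) = (e \in B).
Proof. by rewrite mem_imset // => ? ? []. Qed.

Lemma in_inr (B : {set 'I_m}) k : ((inr k : G) \in inr @: B) = (k \in B).
Proof. by rewrite mem_imset // => ? ? []. Qed.

Lemma inrNinl (B : {set 'I_n}) k : ((inr k : G) \in inl @: B) = false.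
Proof. by apply/imsetP=> -[]. Qed.

(** * Upper bound *)

Section UpperBound.
Variable T : {set {set G}}.
Hypotheses (T2 : pair_family T) (indT : token_independent T).

Let mixed (e : 'I_n) (k : 'I_m) : {set G} := [set inl e; inr k].
Let ME := [set e | [exists k, mixed e k \in T]].
Let MK := [set k | [exists e, mixed e k \in T]].
Let inE2 := [set A in T | A \subset L].
Let inK2 := [set A in T | A \subset ~: L].
Let mix := [set A in T | ~~ (A \subset L) && ~~ (A \subset ~: L)].

Lemma card_family_split : #|T| <= #|mix| + #|inE2| + #|inK2|.
Proof.
have sT : T \subset mix :|: inE2 :|: inK2.
  by apply/subsetP=> A AT; rewrite !inE AT /=; do 2 case: (A \subset _).
apply: leq_trans (subset_leq_card sT) _.
by rewrite (leq_trans (leq_card_setU _ _)) // leq_add2r leq_card_setU.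
Qed.

Lemma pair_family_other (A : {set G}) x : A \in T -> x \in A ->
  exists2 y, x != y & A = [set x; y].
Proof.
move=> AT xA; have /eqP/cards2P[u [v [uv eA]]] := T2 AT.
move: xA; rewrite eA !inE => /orP[]/eqP->; [by exists v|].
by exists u; rewrite 1?eq_sym // setUC.
Qed.

(** Two mixed members through the same [e] would have distinct, hence adjacent, ends in [K_m]; so
    [e] determines its mixed member. *)
Lemma card_mix : #|mix| <= #|ME|.
Proof.
have [->|[A0 A0m]] := set_0Vmem mix; first by rewrite cards0.
have mixP A : A \in mix -> exists e k, A = mixed e k.
  rewrite inE => /and3P[AT /subsetPn[x xA xL] /subsetPn[y yA yL]].
  case: x xA xL => [e|k] xA xL; first by rewrite in_inl inE in xL.
  case: y yA yL => [e|l] yA yL; last by rewrite inE inrNinl in yL.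
  exists e, k; have [z _ eA] := pair_family_other AT yA.
  by move: xA; rewrite eA !inE /= => /eqP <-.
(* ['I_m] may be empty, so the default [k0] is drawn from a member of [mix]; its value is irrelevant
   on [ME]. *)
have [e0 [k0 _]] := mixP _ A0m.
pose f e := odflt k0 [pick k | mixed e k \in T].
suff /subset_leq_card/leq_trans : mix \subset [set mixed e (f e) | e in ME].
  by apply; exact: leq_imset_card.
apply/subsetP=> A Am; have [e [k eA]] := mixP _ Am.
have ekT : mixed e k \in T by rewrite -eA; move: Am; rewrite inE => /andP[].
apply/imsetP; exists e; first by rewrite inE; apply/existsP; exists k.
rewrite eA /f; case: pickP => [l elT /=|/(_ k)]; last by rewrite ekT.
by have /= := indT ekT elT; rewrite negbK => /eqP ->.
Qed.

(** If [e] lies in a mixed member, a pair of [E_n] through [e] would have its other end adjacent to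
    the [K_m] end, as the join links both sides. *)
Lemma card_inE2 : #|inE2| <= 'C(n - #|ME|, 2).
Proof.
have <- : #|(inl @: (~: ME) : {set G})| = n - #|ME|.
  by rewrite card_inl cardsCs setCK card_ord.
rewrite -cards_draws; apply/subset_leq_card/subsetP=> A.
rewrite !inE => /andP[AT /subsetP AL]; rewrite T2 // eqxx andbT.
apply/subsetP=> x xA; have /imsetP[e _ ex] := AL x xA; subst x.
rewrite in_inl !inE; apply/existsP=> -[k ekT].
have [y _ eA] := pair_family_other AT xA.
have /imsetP[e' _ ey] : y \in L by apply: AL; rewrite eA !inE eqxx orbT.
by rewrite eA ey in AT; have := indT AT ekT.
Qed.

(** Members inside [K_m] that meet have equal other ends, so they form a matching; it avoids [MK]
    because the join edges link the other ends. *)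
Lemma card_inK2 : #|inK2|.*2 <= m - #|MK|.
Proof.
have tK : trivIset inK2.
  apply/trivIsetP=> A B; rewrite !inE => /andP[AT AR] /andP[BT BR].
  apply: contraR => /pred0Pn[x /andP[/= xA xB]].
  have [u xu eA] := pair_family_other AT xA.
  have [v xv eB] := pair_family_other BT xB.
  have uR : u \in ~: L by apply: (subsetP AR); rewrite eA !inE eqxx orbT.
  have vR : v \in ~: L by apply: (subsetP BR); rewrite eB !inE eqxx orbT.
  rewrite eA eB in AT BT *; have := indT AT BT.
  case: u {xu eA AT} uR => [e|k]; first by rewrite inE in_inl inE.
  case: v {xv eB BT} vR => [e|l]; first by rewrite inE in_inl inE.
  by move=> _ _ /=; rewrite negbK => /eqP ->.
have -> : #|inK2|.*2 = #|cover inK2|.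
  rewrite -(eqP tK) (eq_bigr (fun _ => 2)) ?sum_nat_const ?muln2 //.
  by move=> A; rewrite inE => /andP[/T2].
have <- : #|(inr @: (~: MK) : {set G})| = m - #|MK|.
  by rewrite card_inr cardsCs setCK card_ord.
apply/subset_leq_card/bigcupsP=> A; rewrite inE => /andP[AT /subsetP AR].
apply/subsetP=> -[e|k] xA; first by have := AR _ xA; rewrite inE in_inl inE.
rewrite in_inr !inE; apply/existsP=> -[e ekT].
have [y _ eA] := pair_family_other AT xA.
rewrite /mixed setUC in ekT; rewrite eA in AT.
have := indT AT ekT; case: y {AT} eA => // e' eA.
by have := AR (inl e'); rewrite eA !inE eqxx orbT in_inl inE => /(_ isT).
Qed.

Lemma ME_MK : (0 < #|ME|) <= #|MK|.
Proof.
case: posnP => // /card_gt0P[e]; rewrite inE => /existsP[k ekT].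
by apply/card_gt0P; exists k; rewrite inE; apply/existsP; exists e.
Qed.

Lemma join_tokens_upper : exists2 a, a <= n &
  #|T| <= a + 'C(n - a, 2) + (m - (0 < a))./2.
Proof.
exists #|ME|; first by rewrite -[X in _ <= X]card_ord max_card.
have := card_family_split; have := card_mix; have := card_inE2.
have := card_inK2; have := ME_MK; lia.
Qed.

End UpperBound.

(** * Lower bound: adding a matching of [K_m] *)

(** The blocks form the matching [{0, 1}, {2, 3}, ...] of [K_m]. *)
Let half_block (i : 'I_m./2) : {set G} := inr @: [set k : 'I_m | k./2 == i].

Lemma card_half_block i : #|half_block i| = 2.
Proof.
have h : i < m./2 by [].
have h0 : i.*2 < m by lia.
have h1 : i.*2.+1 < m by lia.
rewrite card_inr.
have -> : [set k : 'I_m | k./2 == i] = [set Ordinal h0; Ordinal h1].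
  by apply/setP=> k; rewrite !inE -!val_eqE /=; lia.
by rewrite cards2 -val_eqE /=; lia.
Qed.

Lemma half_block_mem i x : x \in half_block i ->
  exists2 k : 'I_m, x = inr k & k./2 = i.
Proof. by case/imsetP=> k; rewrite inE => /eqP; exists k. Qed.

(** The last hypothesis keeps [T] off the matched vertices, so members of [T] and blocks are never
    adjacent and the sizes add up. *)
Lemma join_tokens_lower (T : {set {set G}}) :
    pair_family T -> token_independent T ->
    (forall A k, A \in T -> inr k \in A -> (m./2).*2 <= k) ->
  #|T| + m./2 <= alpha (token2 G).
Proof.
move=> T2 indT sepT.
pose M := [set half_block i | i in [set: 'I_m./2]].
have TM_disj A i : A \in T -> [disjoint A & half_block i].
  move=> AT; apply/pred0Pn=> -[x /andP[/= xA /half_block_mem[k ex ki]]].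
  rewrite ex in xA; have := sepT A k AT xA; have := ltn_ord i; lia.
have cM : #|M| = m./2.
  rewrite card_in_imset ?cardsT ?card_ord // => i j _ _ eij.
  have [x xi] : exists x, x \in half_block i.
    by apply/card_gt0P; rewrite card_half_block.
  have [k ex ki] := half_block_mem xi.
  rewrite eij in xi; have [l ey lj] := half_block_mem xi.
  by apply: val_inj; rewrite /= -ki -lj; case: (etrans (esym ex) ey) => ->.
(* A common member would be disjoint from itself, hence empty. *)
have TM0 : T :&: M = set0.
  apply/setP=> A; rewrite !inE; apply/andP=> -[AT AM].
  have /imsetP[i _ eA] := AM.
  have := TM_disj A i AT; rewrite -eA -setI_eq0 setIid => /eqP A0.
  by have := T2 A AT; rewrite A0 cards0.
have <- : #|T :|: M| = #|T| + m./2 by rewrite cardsU TM0 cards0 subn0 cM.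
have disjP A i x : A \in T -> x \in A -> x \in half_block i -> False.
  by move=> AT xA xi; have /pred0P/(_ x) := TM_disj A i AT; rewrite /= xA xi.
have P2 : pair_family (T :|: M).
  move=> A /setUP[/T2 //|/imsetP[i _ ->]]; exact: card_half_block.
apply: le_alpha_token2 => // x u v xuU xvU.
have xu := cards2_neq (P2 _ xuU); have xv := cards2_neq (P2 _ xvU).
case/setUP: xuU => xuT; case/setUP: xvU => xvT; first exact: indT xuT xvT.
- have /imsetP[i _ e] := xvT.
  by case: (disjP _ i x xuT); rewrite -?e !inE eqxx.
- have /imsetP[i _ e] := xuT.
  by case: (disjP _ i x xvT); rewrite -?e !inE eqxx.
(* Two blocks through [x] coincide, which forces [u = v]. *)
have [i _ ei] := imsetP xuT; have [j _ ej] := imsetP xvT.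
have [k ex ki] : exists2 k : 'I_m, x = inr k & k./2 = i.
  by apply: half_block_mem; rewrite -ei !inE eqxx.
have [l ey lj] : exists2 l : 'I_m, x = inr l & l./2 = j.
  by apply: half_block_mem; rewrite -ej !inE eqxx.
have eij : i = j.
  by apply: val_inj; rewrite /= -ki -lj; case: (etrans (esym ex) ey) => ->.
have : u \in [set x; v] by rewrite ej -eij -ei !inE eqxx orbT.
by rewrite !inE eq_sym (negPf xu) => /eqP ->; rewrite adj_irr.
Qed.

Lemma join_tokens_lower_edgeless : 'C(n, 2) + m./2 <= alpha (token2 G).
Proof.
have <- : #|L| = n by rewrite card_inl cardsT card_ord.
rewrite -cards_draws; apply: join_tokens_lower.
- by move=> A; rewrite inE => /andP[_ /eqP].
- move=> x u v; rewrite !inE => /andP[/subsetP uL _] /andP[/subsetP vL _].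
  have /imsetP[e _ ->] : u \in L by apply: uL; rewrite !inE eqxx orbT.
  by have /imsetP[f _ ->] : v \in L by apply: vL; rewrite !inE eqxx orbT.
- by move=> A k; rewrite inE => /andP[/subsetP AL _] /AL; rewrite inrNinl.
Qed.

(** For odd [m] the last vertex [z] of [K_m] is unmatched, and joining it to every vertex of [E_n]
    gives [n] pairwise nonadjacent tokens. *)
Lemma join_tokens_lower_odd : odd m -> n + m./2 <= alpha (token2 G).
Proof.
move=> om; have lt_m : m.-1 < m by lia.
pose z : G := inr (Ordinal lt_m).
pose T : {set {set G}} := [set [set inl e; z] | e in [set: 'I_n]].
have TP A x : A \in T -> x \in A -> x != z -> exists2 e, x = inl e & A = [set inl e; z].
  case/imsetP=> e _ -> ; rewrite !inE => /orP[]/eqP-> ; last by rewrite eqxx.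
  by exists e.
have T2 : pair_family T by move=> A /imsetP[e _ ->]; rewrite cards2.
have <- : #|T| = n.
  rewrite card_in_imset ?cardsT ?card_ord // => e f _ _ /setP/(_ (inl e)).
  by rewrite !inE eqxx /= orbF => /esym/eqP[].
apply: join_tokens_lower => //.
- move=> x u v xuT xvT.
  have xu := cards2_neq (T2 _ xuT); have xv := cards2_neq (T2 _ xvT).
  have [xz|xz] := eqVneq x z.
    have [||e -> _] := TP _ u xuT; rewrite ?inE ?eqxx ?orbT // -1?xz 1?eq_sym //.
    by have [||f -> _] := TP _ v xvT; rewrite ?inE ?eqxx ?orbT // -1?xz 1?eq_sym.
  (* A vertex other than [z] lies in at most one member, so [u = v]. *)
  have [||e xe eu] := TP _ x xuT; rewrite ?inE ?eqxx //.
  have [||f xf ev] := TP _ x xvT; rewrite ?inE ?eqxx //.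
  have /setP/(_ u) : [set x; u] = [set x; v] by rewrite eu ev -xe -xf.
  by rewrite !inE eqxx orbT eq_sym (negPf xu) => /esym/eqP ->; rewrite adj_irr.
- move=> A k /imsetP[e _ ->]; rewrite !inE /= => /eqP[->] /=; lia.
Qed.

End JoinTokens.

(** * Optimization over [a] and conclusion *)

(** The difference of the binomials is [a (2n - a - 1) / 2], and [2n - a - 1 >= n - 1 >= 2]. *)
Lemma add_bin2_leq n a : 3 <= n -> a <= n -> a + 'C(n - a, 2) <= 'C(n, 2).
Proof.
move=> n3 an; have := mul_bin_diag n 1; have := mul_bin_diag (n - a) 1.
rewrite !bin1; nia.
Qed.

Theorem theorem7 (m n : nat) (hm : 1 <= m) (hn : 2 <= n) :
  alpha (token2 (join (edgeless n) (complete m))) =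
    if n == 2 then uphalf (m + 2) else m./2 + 'C(n, 2).
Proof.
have lowE := join_tokens_lower_edgeless m n.
apply/eqP; rewrite eqn_leq; apply/andP; split.
  apply: alpha_token2_le => T T2 indT.
  have [a an /leq_trans] := join_tokens_upper T2 indT; apply.
  case: eqP => [n2|/eqP n2]; last by have := @add_bin2_leq n a; lia.
  (* For [a] equal to 0, 1, 2 the bounds are [1 + m./2], [1 + (m - 1)./2] and [2 + (m - 1)./2]; the
     last is sharp for odd [m]. *)
  subst n; case: a an => [|[|[|//]]] _; rewrite ?subSS ?subn0 ?binn ?bin_small //=; lia.
case: eqP => [n2|_]; last by rewrite addnC.
subst n; have [om|em] := boolP (odd m).
  have := join_tokens_lower_odd 2 om; lia.
rewrite binn in lowE; lia.
Qed.
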